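(* Let $G$ be a finite cyclic group of order $n\geq 3$ and let $\Gamma_{G,H}$ be the generalized non-coprime graph of $G$ with respect to a subgroup $H\neq\{e\}$ of $G$. Then the following hold: (i) If $p$ is a prime number, $p\mid n$ and $H$ is a $p$-group, then $H\setminus\{e\}$ is a clique in $\Gamma_{G,H}$ and $G\setminus H$ is an independent set of $\Gamma_{G,H}$. (ii) If $G$ is a $p$-group (for some prime $p$) and $H\neq G$, then $\Gamma_{G,H}$ contains $K_{|H|-1,\,|G\setminus H|}$ as a subgraph. In particular, if $G$ is a $2$-group and $H\cong\mathbb{Z}_2$, then $\Gamma_{G,H}\cong K_{1,|G|-2}$. (iii) $\Gamma_{G,H}$ is the complete graph $K_{|G|-1}$ if and only if $G$ is a $p$-group (for some prime $p$) and $H=G$.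
   Context: For a finite group $G$ with identity $e$ and a subgroup $H\neq\{e\}$ of $G$, the generalized non-coprime graph $\Gamma_{G,H}$ is the simple undirected graph with vertex set $G\setminus\{e\}$ in which two distinct vertices $a,b$ are adjacent if and only if $\gcd(|a|,|b|)\neq 1$ and ($a\in H$ or $b\in H$), where $|a|$ denotes the order of the element $a$. $K_m$ is the complete graph on $m$ vertices and $K_{m,k}$ is the complete bipartite graph with parts of sizes $m$ and $k$. *)

(* Defs.v *)
From HB Require Import structures.
From mathcomp Require Import all_boot all_fingroup all_algebra all_solvable.

Set Implicit Arguments.
Unset Strict Implicit.
Unset Printing Implicit Defensive.

Import GroupScope.

Record simple_graph := SimpleGraph {
  vertex :> finType;
  adj : rel vertex;
  adj_sym : symmetric adj;
  adj_irr : irreflexive adj }.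

Arguments adj : clear implicits.

Definition graph_iso (X Y : simple_graph) : Prop :=
  exists f : X -> Y, bijective f /\ forall a b, adj Y (f a) (f b) = adj X a b.

(* Not necessarily an induced subgraph: edges of X are preserved, while
   non-edges of X may become edges of Y. *)
Definition contains_subgraph (Y X : simple_graph) : Prop :=
  exists f : X -> Y, injective f /\ forall a b, adj X a b -> adj Y (f a) (f b).

Definition clique (X : simple_graph) (S : {set X}) : Prop :=
  forall a b, a \in S -> b \in S -> a != b -> adj X a b.

Definition independent (X : simple_graph) (S : {set X}) : Prop :=
  forall a b, a \in S -> b \in S -> ~~ adj X a b.

Section CompleteGraphs.

Variables m k : nat.

Definition complete_adj : rel 'I_m := fun i j => i != j.

Fact complete_adj_sym : symmetric complete_adj.
Proof. by move=> i j; rewrite /complete_adj eq_sym. Qed.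

Fact complete_adj_irr : irreflexive complete_adj.
Proof. by move=> i; rewrite /complete_adj eqxx. Qed.

Definition complete_graph : simple_graph :=
  SimpleGraph complete_adj_sym complete_adj_irr.

Definition bipartite_adj : rel ('I_m + 'I_k)%type := fun u v =>
  match u, v with
  | inl _, inr _ | inr _, inl _ => true
  | _, _ => false
  end.

Fact bipartite_adj_sym : symmetric bipartite_adj.
Proof. by move=> [i|i] [j|j]. Qed.

Fact bipartite_adj_irr : irreflexive bipartite_adj.
Proof. by move=> [i|i]. Qed.

Definition complete_bipartite : simple_graph :=
  SimpleGraph bipartite_adj_sym bipartite_adj_irr.

End CompleteGraphs.

Section NonCoprimeGraph.

Variables (gT : finGroupType) (G H : {group gT}).

Definition nontrivial_elt : finType := {x : gT | x \in G^#}.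

Definition noncoprime_adj : rel nontrivial_elt := fun a b =>
  [&& a != b, gcdn #[val a] #[val b] != 1%N
    & (val a \in H) || (val b \in H)].

Fact noncoprime_adj_sym : symmetric noncoprime_adj.
Proof.
by move=> a b; rewrite /noncoprime_adj eq_sym gcdnC [(val a \in H) || _]orbC.
Qed.

Fact noncoprime_adj_irr : irreflexive noncoprime_adj.
Proof. by move=> a; rewrite /noncoprime_adj eqxx. Qed.

Definition noncoprime_graph : simple_graph :=
  SimpleGraph noncoprime_adj_sym noncoprime_adj_irr.

Definition vertices_in (A : {set gT}) : {set noncoprime_graph} :=
  [set a : nontrivial_elt | val a \in A].

End NonCoprimeGraph.

(* Main.v *)
Require Import Defs.
From HB Require Import structures.
From mathcomp Require Import all_boot all_fingroup all_algebra all_solvable.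

Set Implicit Arguments.
Unset Strict Implicit.
Unset Printing Implicit Defensive.

Import GroupScope.

(** Two facts about orders drive everything. In a [p]-group every nontrivial
element has order divisible by [p], so the gcd condition in the definition of
the graph is automatic there ([pgroup_noncoprime]); and an edge always has an
endpoint in [H], so [G :\: H] is independent for any [H]
([independent_outside]). Parts (i) and (ii) follow: inside a [p]-group, [H^#]
is completely joined to [G :\: H], and when [#|H| = 2] there are no further
edges, since [H^#] is a single vertex.

For (iii), being isomorphic to a complete graph means that all distinct
vertices are adjacent ([complete_graph_isoP]). If two primes divided [#|G|],
Cauchy's theorem would give vertices of distinct prime orders, which are not
adjacent; so [G] is a [p]-group. If [H] were proper, then [#|G :\: H|] would be
at least half of [#|G| >= 3], and [G :\: H] would contain two distinct
nonadjacent vertices. *)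

Lemma graph_iso_sym (X Y : simple_graph) : graph_iso X Y -> graph_iso Y X.
Proof.
case=> f [[g fK gK] fE]; exists g; split; first by exists f.
by move=> a b; rewrite -fE !gK.
Qed.

Lemma complete_graph_isoP (X : simple_graph) (m : nat) (oX : #|X| = m) :
  graph_iso X (complete_graph m) <-> clique [set: X].
Proof.
split=> [[f [bij_f fE]] a b _ _ neq_ab | Kx].
  by rewrite -fE /= /complete_adj (bij_eq bij_f).
have bij_f : bijective (fun x : X => cast_ord oX (enum_rank x)).
  apply: bij_comp (enum_rank_bij X).
  by exists (cast_ord (esym oX)); [exact: cast_ordK | exact: cast_ordKV].
exists (fun x => cast_ord oX (enum_rank x)); split=> // a b.
rewrite /= /complete_adj (bij_eq bij_f).
by have [-> | /Kx->] := eqVneq a b; rewrite ?adj_irr ?inE.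
Qed.

Section Bipartite.

Variables (X : simple_graph) (A B : {set X}).

Definition bipartite_enum (u : complete_bipartite #|A| #|B|) : X :=
  match u with inl i => enum_val i | inr j => enum_val j end.

Lemma bipartite_enum_inj : [disjoint A & B] -> injective bipartite_enum.
Proof.
move=> dAB; have neqAB i j : bipartite_enum (inl i) <> bipartite_enum (inr j).
  move=> /= eqij; have := disjointFr dAB (enum_valP i).
  by rewrite eqij enum_valP.
by move=> [i|i] [j|j] => [/enum_val_inj->|/neqAB|/esym/neqAB|/enum_val_inj->].
Qed.

Hypothesis dAB : [disjoint A & B].
Hypothesis joinAB : forall a b, a \in A -> b \in B -> adj X a b.

Lemma contains_complete_bipartite :
  contains_subgraph X (complete_bipartite #|A| #|B|).
Proof.
exists bipartite_enum; split; first exact: bipartite_enum_inj.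
move=> [i|i] [j|j] //= _; last rewrite adj_sym.
  by apply: joinAB; exact: enum_valP.
by apply: joinAB; exact: enum_valP.
Qed.

Lemma complete_bipartite_iso :
    A :|: B = [set: X] -> independent A -> independent B ->
  graph_iso X (complete_bipartite #|A| #|B|).
Proof.
move=> covAB indA indB; apply: graph_iso_sym; exists bipartite_enum; split.
  apply: (inj_card_bij (bipartite_enum_inj dAB)).
  by rewrite card_sum !card_ord -cardsT -covAB leq_card_setU.
move=> [i|i] [j|j] /=.
- by apply/negbTE/indA; exact: enum_valP.
- by apply: joinAB; exact: enum_valP.
- by rewrite adj_sym; apply: joinAB; exact: enum_valP.
- by apply/negbTE/indB; exact: enum_valP.
Qed.

End Bipartite.

(** Both orders are powers of [p] greater than 1, so [p] divides their gcd. *)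
Lemma pgroup_noncoprime (gT : finGroupType) (p : nat) (K : {group gT}) x y :
  p.-group K -> x \in K^# -> y \in K^# -> gcdn #[x] #[y] != 1%N.
Proof.
move=> pK /setD1P[ntx Kx] /setD1P[nty Ky].
have dvd_p z : z != 1 -> z \in K -> prime p /\ p %| #[z].
  move=> ntz Kz; have pz : p.-group <[z]> by apply: pgroupS pK; rewrite cycle_subG.
  by have [|p_pr p_dv _] := pgroup_pdiv pz; rewrite ?cycle_eq1.
have [[p_pr px] [_ py]] := (dvd_p x ntx Kx, dvd_p y nty Ky).
apply/eqP=> gcd1; have : p %| gcdn #[x] #[y] by rewrite dvdn_gcd px.
by rewrite gcd1 dvdn1 => /eqP p1; rewrite p1 in p_pr.
Qed.

Section NonCoprime.

Variables (gT : finGroupType) (G H : {group gT}).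
Hypothesis sHG : H \subset G.

Let V := vertices_in G H.

Lemma card_vertices_in (A : {set gT}) : A \subset G^# -> #|V A| = #|A|.
Proof.
move=> sAG; rewrite -(card_imset _ val_inj); congr #|pred_of_set _|.
apply/setP=> x; apply/imsetP/idP => [[a] | Ax]; first by rewrite inE => Aa ->.
by exists (Sub x (subsetP sAG x Ax)); rewrite ?inE.
Qed.

Lemma card_noncoprime_graph : #|noncoprime_graph G H| = (#|G| - 1)%N.
Proof. by rewrite /= card_sig (cardsD1 1 G) group1 subn1. Qed.

Lemma card_outside : #|V (G :\: H)| = #|G :\: H|.
Proof. by rewrite card_vertices_in // setDS // sub1G. Qed.

Lemma card_inside : #|V (H :\ 1)| = (#|H| - 1)%N.
Proof.
by rewrite card_vertices_in ?setSD // (cardsD1 1 H) group1 subn1.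
Qed.

Lemma inside_outside_disjoint : [disjoint V (H :\ 1) & V (G :\: H)].
Proof.
by rewrite -setI_eq0; apply/eqP/setP=> a; rewrite !inE; case: (_ \in H); rewrite !andbF.
Qed.

Lemma inside_outside_cover : V (H :\ 1) :|: V (G :\: H) = setT.
Proof.
apply/setP=> -[x Gx]; rewrite !inE /=.
by move: Gx; rewrite !inE => /andP[-> ->]; case: (_ \in H).
Qed.

Lemma independent_outside : independent (V (G :\: H)).
Proof.
move=> a b; rewrite !inE => /andP[Ha _] /andP[Hb _].
by rewrite /= /noncoprime_adj (negbTE Ha) (negbTE Hb) !andbF.
Qed.

Lemma clique_inside (p : nat) : p.-group H -> clique (V (H :\ 1)).
Proof.
move=> pH a b Va Vb neq_ab.
have [Ha Hb] : val a \in H^# /\ val b \in H^# by move: Va Vb; rewrite !inE.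
rewrite /= /noncoprime_adj neq_ab (pgroup_noncoprime pH Ha Hb) /=.
by case/setD1P: Ha => _ ->.
Qed.

Lemma join_inside_outside (p : nat) : p.-group G ->
  forall a b, a \in V (H :\ 1) -> b \in V (G :\: H) ->
  adj (noncoprime_graph G H) a b.
Proof.
move=> pG a b; rewrite !inE => /andP[_ Ha] /andP[nHb _].
rewrite /= /noncoprime_adj Ha (pgroup_noncoprime pG (valP a) (valP b)) andbT.
by apply: contraNneq nHb => <-.
Qed.

(** Cauchy's theorem provides vertices of each prime order dividing [#|G|];
completeness makes any two of them noncoprime. *)
Lemma clique_pgroup : clique [set: noncoprime_graph G H] ->
  (pdiv #|G|).-group G.
Proof.
move=> KG; apply/pgroupP=> q q_pr qG; set p := pdiv _.
have p_pr : prime p.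
  by apply: pdiv_prime; apply: leq_trans (prime_gt1 q_pr) (dvdn_leq _ qG).
have vertex_of r : prime r -> r %| #|G| -> exists a : noncoprime_graph G H,
    #[val a] = r.
  move=> r_pr /(Cauchy r_pr)[x Gx ox].
  suffices Gx1 : x \in G^# by exists (Sub x Gx1).
  by rewrite !inE Gx -order_gt1 ox prime_gt1.
have [a oa] := vertex_of p p_pr (pdiv_dvd _).
have [b ob] := vertex_of q q_pr qG.
have [eq_ab | neq_ab] := eqVneq a b; first by rewrite inE -ob -eq_ab oa.
have /and3P[_ + _] := KG a b (in_setT a) (in_setT b) neq_ab.
by rewrite oa ob -/(coprime p q) prime_coprime // dvdn_prime2 // negbK eq_sym.
Qed.

(** A proper subgroup has index at least 2, so its complement has at least
[#|G| / 2 > 1] elements, all of them pairwise nonadjacent. *)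
Lemma clique_full : 3 <= #|G| -> clique [set: noncoprime_graph G H] ->
  H :=: G.
Proof.
move=> G_ge3 KG; apply/eqP; rewrite eqEsubset sHG -indexg_eq1 eqn_leq indexg_gt0.
rewrite andbT leqNgt; apply/negP=> iHG.
have : 1 < #|V (G :\: H)|.
  rewrite card_outside cardsD (setIidPr sHG).
  have: #|H| * 2 <= #|G| by rewrite -(Lagrange sHG) leq_mul2l iHG orbT.
  rewrite muln2 -addnn ltn_subRL => le2H.
  (* Doubling avoids halving [#|G|]: [2 * #|H| + 2 < #|G| + #|G|] adds the two
     bounds [2 * #|H| <= #|G|] and [3 <= #|G|]. *)
  have: (#|H| + 1).*2 < #|G|.*2.
    rewrite doubleD -[in X in _ < X]addnn -addnn -addnS.
    exact: leq_add le2H G_ge3.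
  by rewrite ltn_double.
case/card_gt1P=> a [b [Va Vb neq_ab]].
by have := independent_outside Va Vb; rewrite KG ?inE.
Qed.

End NonCoprime.

Theorem lemma2p6 (gT : finGroupType) (G H : {group gT}) (n : nat)
    (cycG : cyclic G) (oG : #|G| = n) (n_ge3 : 3 <= n)
    (sHG : H \subset G) (ntH : H :!=: 1) :
  (* (i) *)
  (forall p : nat, prime p -> p %| n -> p.-group H ->
     clique (vertices_in G H (H :\ 1)) /\
     independent (vertices_in G H (G :\: H)))
  (* (ii) *)
  /\ ((forall p : nat, prime p -> p.-group G -> H :!=: G ->
        contains_subgraph (noncoprime_graph G H)
          (complete_bipartite (#|H| - 1) #|G :\: H|))
      /\ (2.-group G -> H \isog Zp 2 ->
        graph_iso (noncoprime_graph G H) (complete_bipartite 1 (#|G| - 2))))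
  (* (iii) *)
  /\ (graph_iso (noncoprime_graph G H) (complete_graph (#|G| - 1))
      <-> (exists p : nat, prime p /\ p.-group G) /\ H :=: G).
Proof.
have isoP := complete_graph_isoP (card_noncoprime_graph G H).
rewrite -oG in n_ge3.
split; [|split; [split|]].
- move=> p _ _ pH; split; first exact: clique_inside pH.
  exact: independent_outside.
- move=> p _ pG _; rewrite -(card_inside sHG) -card_outside.
  apply: contains_complete_bipartite; first exact: inside_outside_disjoint.
  exact: join_inside_outside pG.
- move=> pG isoH; have oH : #|H| = 2 by rewrite (card_isog isoH) card_Zp.
  have o1 : 1%N = #|vertices_in G H (H :\ 1)| by rewrite card_inside ?oH.
  have -> : (#|G| - 2)%N = #|vertices_in G H (G :\: H)|.
    by rewrite card_outside cardsD (setIidPr sHG) oH.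
  rewrite [in complete_bipartite 1 _]o1; apply: complete_bipartite_iso.
  + exact: inside_outside_disjoint.
  + exact: join_inside_outside pG.
  + exact: inside_outside_cover.
  + (* A single vertex is independent because the graph has no loops. *)
    have /cards1P[c ->] : #|vertices_in G H (H :\ 1)| == 1%N by rewrite -o1.
    by move=> a b /set1P-> /set1P->; rewrite adj_irr.
  + exact: independent_outside.
- split=> [/isoP KG | [[p [_ pG]] eqHG]].
    split; last exact: clique_full.
    exists (pdiv #|G|); split; last exact: clique_pgroup KG.
    exact/pdiv_prime/ltnW.
  have VT : vertices_in G H (H :\ 1) = setT.
    by rewrite -(inside_outside_cover G H) eqHG setDv; apply/setP=> a; rewrite !inE orbF.
  by apply/isoP; rewrite -VT; apply: (@clique_inside _ _ _ p); rewrite eqHG.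
Qed.
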